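(* Consider finite sets $A$ and $B$, a set $\mathcal{X}\subseteq B^A$ of functions $F:A\to B$, and a map $\mathcal{H}:\mathcal{X}\to\{0,1\}$ which assigns a label to each function in $\mathcal{X}$. Given oracle access to an unknown function $F^*\in\mathcal{X}$, the problem is to compute $\mathcal{H}(F^* )$ using as few queries to $F^*$ as possible. Let $r:\mathcal{X}\times\mathcal{X}\to\mathbb{R}_{\ge 0}$ be a non-zero symmetric function with $r(F_1,F_2)=0$ whenever $\mathcal{H}(F_1)=\mathcal{H}(F_2)$. For each $\mathcal{Z}\subseteq\mathcal{X}$ define $$M(\mathcal{Z})=\sum_{F_1\in\mathcal{Z}}\sum_{F_2\in\mathcal{X}}r(F_1,F_2),\qquad q(\mathcal{Z})=\max_{a\in A}\sum_{F_1\in\mathcal{Z}}\sum_{F_2\in\mathcal{Z}}r(F_1,F_2)\cdot\mathbf{1}_{\{F_1(a)\ne F_2(a)\}}.$$ If there exists a subset $\mathcal{Z}\subseteq\mathcal{X}$ with $q(\mathcal{Z})>0$, then the randomized query complexity of the problem is at least $$\min_{\mathcal{Z}\subseteq\mathcal{X}:\ q(\mathcal{Z})>0}\frac{M(\mathcal{Z})}{100\cdot q(\mathcal{Z})}.$$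
   Context: The sets $A,B,\mathcal{X}$ and the map $\mathcal{H}$ are known to the algorithm; only queries to $F^*$ are counted. A query names $a\in A$ and receives $F^*(a)$. Randomized query complexity: the minimum over randomized algorithms that, for every input $F^*\in\mathcal{X}$, output the correct answer with probability at least $9/10$, of the worst-case (over inputs) expected number of queries, the expectation being over the algorithm's coin tosses. *)

(* Defs.v *)
From mathcomp Require Import all_boot all_order all_algebra.
From mathcomp Require Import all_classical all_reals all_analysis.

Set Implicit Arguments.
Unset Strict Implicit.
Unset Printing Implicit Defensive.

Import Order.TTheory GRing.Theory Num.Theory.

Local Open Scope classical_set_scope.
Local Open Scope ring_scope.

(** The members of [X], as a finite type; [val F : {ffun A -> B}]. *)
Definition instance (A B : finType) (X : {set {ffun A -> B}}) : finType :=
  {F : {ffun A -> B} | F \in X}.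

Section Deterministic.
Variables A B : finType.

(** A deterministic query algorithm decides, from the answers received so far
    (oldest first), either to query a point ([inl a]) or to halt with an output
    ([inr b]).  The earlier queries need not be recorded, as they are determined
    by the earlier answers.  Nothing forces it to halt. *)
Definition strategy : Type := seq B -> A + bool.

(** Answers received within the first [n] steps; constant once [s] has halted. *)
Fixpoint answers (s : strategy) (F : {ffun A -> B}) (n : nat) : seq B :=
  if n is m.+1 then
    let h := answers s F m in
    if s h is inl a then rcons h (F a) else h
  else [::].

Definition outputs (s : strategy) (F : {ffun A -> B}) (b : bool) : Prop :=
  exists n, s (answers s F n) = inr b.

(** Total number of queries of [s] on [F]; it is [+oo] if [s] never halts. *)
Definition num_queries (R : realType) (s : strategy) (F : {ffun A -> B})
    : \bar R :=
  (\sum_(0 <= n <oo) (if s (answers s F n) is inl _ then 1 else 0))%E.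

End Deterministic.

(** All the coins are tossed in advance: a randomized algorithm is a random
    strategy on an arbitrary probability space.  As [seq B] is countable and
    [A + bool] finite, [measurable_choice] says that the random strategy is
    measurable for the product sigma-algebra. *)
Record randomized_algorithm (R : realType) (A B : finType) := RandomizedAlgorithm {
  coins_display : measure_display;
  coins : measurableType coins_display;
  coins_prob : probability coins R;
  run : coins -> strategy A B;
  measurable_choice : forall (h : seq B) (c : A + bool),
    measurable [set w : coins | run w h = c]
}.

Arguments coins {R A B} r.
Arguments coins_prob {R A B} r.
Arguments run {R A B} r w h.

Section QueryComplexity.
Variables (R : realType) (A B : finType) (X : {set {ffun A -> B}}).
Variable H : instance X -> bool.

Definition correct (alg : randomized_algorithm R A B) : Prop :=
  forall F : instance X,
    ((9 / 10 : R)%:E <=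
       coins_prob alg [set w | outputs (run alg w) (val F) (H F)])%E.

Definition expected_queries (alg : randomized_algorithm R A B)
    (F : instance X) : \bar R :=
  (\int[coins_prob alg]_w num_queries R (run alg w) (val F))%E.

Definition worst_case_queries (alg : randomized_algorithm R A B) : \bar R :=
  ereal_sup (range (expected_queries alg)).

Definition randomized_query_complexity : \bar R :=
  ereal_inf [set c | exists2 alg, correct alg & worst_case_queries alg = c].

End QueryComplexity.

Section Weights.
Variables (R : realType) (A B : finType) (X : {set {ffun A -> B}}).
Variable r : instance X -> instance X -> R.

Definition total_weight (Z : {set instance X}) : R :=
  \sum_(F1 in Z) \sum_(F2 : instance X) r F1 F2.

(** Intended for [r >= 0]: the default value [0] only matters when [A] is
    empty. *)
Definition max_separated_weight (Z : {set instance X}) : R :=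
  \big[Num.max/0]_(a : A)
    \sum_(F1 in Z) \sum_(F2 in Z) r F1 F2 * (val F1 a != val F2 a)%:R.

End Weights.

(* Main.v *)
Require Import Defs.
From mathcomp Require Import all_boot all_order all_algebra.
From mathcomp Require Import all_classical all_reals all_analysis.
From mathcomp Require Import measurable_realfun.
From mathcomp Require Import lra.

(** Let [w F = \sum_F' r F F'] and let [K >= 0] satisfy [K q(Z) <= M(Z)] for all
    [Z].  Run a fixed strategy on all instances at once.  At each step the
    instances fall into classes [Z] with equal answers so far; a class that
    queries separates pairs of weight at most [q(Z) <= M(Z) / K], and [M(Z)] is
    the [w]-weight of the instances making this query.  Hence [K] times the
    weight of all pairs ever separated is at most [\sum_F w F * #queries on F].
    A pair of positive weight has two different labels, so it is separated
    unless the output is wrong on one of its members; by symmetry of [r] the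
    unseparated pairs weigh at most twice the [w]-weight of the wrong instances.
    Averaging over the coins bounds that by [2 / 10] of the total weight, so
    some instance costs at least [(8 / 10) K] queries in expectation; the
    theorem only needs [K / 100]. *)

Set Implicit Arguments.
Unset Strict Implicit.
Unset Printing Implicit Defensive.

Import Order.TTheory GRing.Theory Num.Theory.

Local Open Scope ring_scope.

(** * Preliminaries on strategies and weights *)

Definition queries_at (A B : finType) (s : strategy A B) (F : {ffun A -> B})
    (n : nat) : bool :=
  if s (answers s F n) is inl _ then true else false.

Lemma answers_halted (A B : finType) (s : strategy A B) (F : {ffun A -> B})
    (b : bool) (n m : nat) :
  s (answers s F n) = inr b -> (n <= m)%N -> answers s F m = answers s F n.
Proof.
move=> halt /subnK <-; elim: (m - n)%N => //= k IH.
by rewrite IH halt.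
Qed.

Lemma total_weightT (R : realType) (A B : finType) (X : {set {ffun A -> B}})
    (r : instance X -> instance X -> R) :
  total_weight r [set: instance X] = \sum_F1 \sum_F2 r F1 F2.
Proof. by apply: eq_bigl => F; rewrite inE. Qed.

(** * Pairs separated by a fixed strategy *)

Section Separation.
Variables (R : realType) (A B : finType) (X : {set {ffun A -> B}}).
Variables (H : instance X -> bool) (r : instance X -> instance X -> R).
Hypothesis r_ge0 : forall F1 F2, 0 <= r F1 F2.
Hypothesis r_sym : forall F1 F2, r F1 F2 = r F2 F1.
Hypothesis r_label : forall F1 F2, H F1 = H F2 -> r F1 F2 = 0.
Variable K : R.
Hypothesis K_ge0 : 0 <= K.
Hypothesis K_le : forall Z : {set instance X},
  K * max_separated_weight r Z <= total_weight r Z.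
Variable s : strategy A B.

Let ans n (F : instance X) := answers s (val F) n.

Lemma step_separation n :
  K * (\sum_F1 \sum_F2 r F1 F2 *
         ((ans n F1 == ans n F2) && (ans n.+1 F1 != ans n.+1 F2))%:R)
    <= \sum_F (\sum_F' r F F') * (queries_at s (val F) n)%:R.
Proof.
(* Both sides are split over the classes of equal answers; a set [Z] that is not such a class
   contributes zero to each. *)
pose cl F := [set F' | ans n F' == ans n F].
rewrite (partition_big cl predT) //= [leRHS](partition_big cl predT) //=.
rewrite mulr_sumr; apply: ler_sum => Z _.
have [F0 /eqP clF0|noF0] := pickP (fun F => cl F == Z); last first.
  by rewrite !big_pred0 // mulr0.
have clE F : (cl F == Z) = (F \in Z).
  apply/eqP/idP => [<-|]; first by rewrite inE.
  rewrite -clF0 inE => /eqP e; apply/setP => F'.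
  by rewrite !inE e.
have ansE F : F \in Z -> ans n F = ans n F0 by rewrite -clF0 inE => /eqP.
rewrite !(eq_bigl _ _ clE).
(* The common answers fix the next move of the whole class: halting splits no pair, and a query at
   [a] splits exactly the pairs counted by the term [a] of the maximum
   [max_separated_weight r Z]. *)
case e : (s (ans n F0)) => [a|b]; last first.
  rewrite big1 ?mulr0.
    by apply: sumr_ge0 => F _; rewrite mulr_ge0 // sumr_ge0.
  move=> F1 /ansE e1; rewrite big1 // => F2 _.
  have [e2|_] := eqVneq (ans n F1) (ans n F2); last by rewrite mulr0.
  rewrite /= /ans /= -/(ans n F1) -/(ans n F2) -e2 e1 e.
  by rewrite -e1 eqxx mulr0.
have -> : \sum_(F in Z) (\sum_F' r F F') * (queries_at s (val F) n)%:R
    = total_weight r Z.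
  apply: eq_bigr => F /ansE eF.
  by rewrite /queries_at -/(ans n F) eF e mulr1.
apply: le_trans (K_le Z); apply: ler_wpM2l => //.
apply: le_trans (le_bigmax _ _ a); rewrite le_eqVlt; apply/orP; left.
apply/eqP; apply: eq_bigr => F1 F1Z.
rewrite [in RHS]big_mkcond /=; apply: eq_bigr => F2 _.
have -> : (ans n F1 == ans n F2) = (F2 \in Z).
  by rewrite -clF0 inE (ansE _ F1Z) eq_sym.
case: ifPn => F2Z; last by rewrite mulr0.
rewrite /ans /= -/(ans n F1) -/(ans n F2) (ansE _ F1Z) (ansE _ F2Z) e.
by rewrite eqseq_rcons eqxx.
Qed.

(** Summation over the steps: answers that differ after [N.+1] steps either differed after [N] steps
    or were split by step [N], which [step_separation] charges to the queries of that step. *)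
Lemma separation N :
  K * (\sum_F1 \sum_F2 r F1 F2 * (ans N F1 != ans N F2)%:R)
    <= \sum_F (\sum_F' r F F') * \sum_(n < N) (queries_at s (val F) n)%:R.
Proof.
elim: N => [|N IH].
  under eq_bigr do under eq_bigr do rewrite eqxx mulr0.
  under eq_bigr do rewrite big1 //.
  rewrite big1 // mulr0; apply: sumr_ge0 => F _.
  by rewrite big_ord0 mulr0.
under [leRHS]eq_bigr do rewrite big_ord_recr /= mulrDr.
rewrite big_split /=; apply: le_trans (lerD IH (step_separation N)).
rewrite -mulrDr; apply: ler_wpM2l => //; rewrite -big_split /=.
apply: ler_sum => F1 _; rewrite -big_split /=; apply: ler_sum => F2 _.
rewrite -mulrDr; apply: ler_wpM2l => //.
by do 2 case: eqP => _ /=; rewrite ?addr0 ?add0r.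
Qed.

Definition succeeds (F : instance X) : Prop := outputs s (val F) (H F).

(** There are finitely many instances, so one [N] bounds the halting times of all succeeding ones.
    From then on, equal answers force equal outputs. *)
Lemma succeeds_separated : exists N : nat, forall F1 F2 : instance X,
  succeeds F1 -> succeeds F2 -> H F1 != H F2 -> ans N F1 != ans N F2.
Proof.
have /choice[f fP] : forall F : instance X, exists n : nat,
    succeeds F -> s (ans n F) = inr (H F).
  by move=> F; have [[n nP]|?] := EM (succeeds F); [exists n | exists 0%N].
exists (\max_F f F)%N => F1 F2 R1 R2; apply: contraNneq.
have halted F : succeeds F -> s (ans (\max_F f F)%N F) = inr (H F).
  by move=> RF; rewrite /ans (answers_halted (fP _ RF)) ?fP // leq_bigmax.
by move=> e; move: (halted _ R1); rewrite e halted // => -[->].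
Qed.


(** The bound for one outcome of the coins, to be integrated later; it lives in [\bar R] because
    [num_queries] may be infinite. The factor [2] in the penalty lets a failing instance pay in
    either position of a pair. *)
Lemma weight_le_queries :
  ((K * total_weight r [set: instance X])%:E <=
    \sum_F (\sum_F' r F F')%:E *
      (num_queries R s (val F) + (2 * K)%:E * (~~ `[< succeeds F >])%:R%:E))%E.
Proof.
have [N NP] := succeeds_separated.
pose bad (F : instance X) : R := (~~ `[< succeeds F >])%:R.
have w_ge0 F : 0 <= \sum_F' r F F' by exact: sumr_ge0.
(* Only queries in the first [N] steps are kept: they already separate all succeeding instances with
   different labels. *)
apply: (@le_trans _ _ (\sum_F (\sum_F' r F F')%:E *
    ((\sum_(n < N) (queries_at s (val F) n)%:R)%:E + (2 * K * bad F)%:E))%E);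
    last first.
  apply: lee_sum => F _; apply: lee_wpmul2l; first by rewrite lee_fin.
  rewrite -EFinM leeD2r // /num_queries -sumEFin.
  rewrite -(big_mkord predT (fun n => (queries_at s (val F) n)%:R%:E)).
  rewrite [leRHS](eq_eseriesr (g := fun n => (queries_at s (val F) n)%:R%:E)).
    by apply: nneseries_lim_ge => n _ _; rewrite lee_fin.
  by move=> n _; rewrite /queries_at; case: (s _).
under eq_bigr do rewrite -EFinD -EFinM.
rewrite sumEFin lee_fin.
under eq_bigr do rewrite mulrDr.
rewrite big_split /=; apply: le_trans (lerD (separation N) (lexx _)).
(* By symmetry of [r], the doubled weight of the failing instances is a charge to each pair for both
   of its members. *)
have -> : \sum_F (\sum_F' r F F') * (2 * K * bad F)
    = K * \sum_F1 \sum_F2 r F1 F2 * (bad F1 + bad F2).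
  under [in RHS]eq_bigr => F1 _ do (under eq_bigr do rewrite mulrDr;
    rewrite big_split -mulr_suml /=).
  rewrite big_split /= [X in _ = K * (_ + X)]exchange_big /=.
  under [X in _ = K * (_ + X)]eq_bigr => F2 _ do
    (rewrite -mulr_suml; under eq_bigr do rewrite r_sym).
  rewrite -mulr2n -[in RHS]mulr_natl mulrA [K * 2]mulrC mulr_sumr.
  by apply: eq_bigr => F _; rewrite mulrCA.
rewrite -mulrDr; apply: ler_wpM2l => //; rewrite -big_split /=.
rewrite total_weightT.
apply: ler_sum => F1 _; rewrite -big_split /=; apply: ler_sum => F2 _.
have [/r_label->|neqH] := eqVneq (H F1) (H F2); first by rewrite !mul0r addr0.
rewrite -mulrDr -[leLHS]mulr1; apply: ler_wpM2l => //.
(* The labels differ here: either both members succeed and [NP] separates them, or some [bad] term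
   is already [1]. *)
rewrite /bad; case: asboolP => S1 /=; case: asboolP => S2 /=.
- by rewrite NP // !addr0.
- by rewrite add0r lerDr.
- by rewrite addr0 lerDr.
- by rewrite addrA lerDr addr_ge0.
Qed.
End Separation.

(** * Measurability in the coins *)

Section Measurability.
Variables (R : realType) (A B : finType) (alg : randomized_algorithm R A B).
Variable F : {ffun A -> B}.
Local Open Scope classical_set_scope.

Lemma measurable_run (h : seq B) (P : A + bool -> Prop) :
  measurable [set w | P (run alg w h)].
Proof.
have -> : [set w | P (run alg w h)]
    = \bigcup_(c in P) [set w | run alg w h = c].
  by apply/seteqP; split => [w Pw|w [c Pc /= ->]//]; exists (run alg w h).
apply: fin_bigcup_measurable => [|c _]; first exact: finite_finset.
exact: measurable_choice.
Qed.

(** Induction on [n], splitting over the previous answers: they range over the countable type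
    [seq B], and for fixed ones [measurable_run] covers the next move. *)
Lemma measurable_answers (n : nat) (h : seq B) :
  measurable [set w | answers (run alg w) F n = h].
Proof.
elim: n h => [|n IH] h /=.
  have [<-|neq] := EM ([::] = h).
    rewrite [X in measurable X](_ : _ = setT) //.
    by apply/seteqP; split.
  rewrite [X in measurable X](_ : _ = set0) //.
  by apply/seteqP; split.
pose next (g : seq B) (c : A + bool) := if c is inl a then rcons g (F a) else g.
rewrite [X in measurable X](_ : _ = \bigcup_g
    ([set w | answers (run alg w) F n = g] `&`
     [set w | next g (run alg w g) = h])).
  apply: countable_bigcupT_measurable => // g; apply: measurableI => //.
  exact: (measurable_run g (fun c => next g c = h)).
apply/seteqP; split => [w <-|w [g _ /= [<-]]//].
by exists (answers (run alg w) F n).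
Qed.

Lemma measurable_action (n : nat) (P : A + bool -> Prop) :
  measurable [set w | P (run alg w (answers (run alg w) F n))].
Proof.
rewrite [X in measurable X](_ : _ = \bigcup_g
    ([set w | answers (run alg w) F n = g] `&` [set w | P (run alg w g)])).
  apply: countable_bigcupT_measurable => // g.
  by apply: measurableI; [exact: measurable_answers | exact: measurable_run].
apply/seteqP; split => [w Pw|w [g _ /= [<-]]//].
by exists (answers (run alg w) F n).
Qed.

Lemma measurable_outputs (b : bool) :
  measurable [set w | outputs (run alg w) F b].
Proof.
rewrite [X in measurable X](_ : _ = \bigcup_n
    [set w | run alg w (answers (run alg w) F n) = inr b]).
  apply: bigcupT_measurable => n.
  exact: (measurable_action n (fun c => c = inr b)).
by apply/seteqP; split => [w [n ?]|w [n _ ?]]; exists n.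
Qed.

Lemma num_queries_ge0 (s : strategy A B) : (0 <= num_queries R s F)%E.
Proof. by apply: nneseries_ge0 => n _ _; case: (s _) => // _; exact: lee01. Qed.

Lemma measurable_num_queries :
  measurable_fun setT
    ((fun w => num_queries R (run alg w) F) : coins alg -> \bar R).
Proof.
apply: (ge0_emeasurable_sum (P := predT)) => [n w _ _|n _].
  by case: (run alg w _) => // _; exact: lee01.
pose q := [set w | queries_at (run alg w) F n].
have mq : measurable q.
  exact: (measurable_action n
    (fun c => (if c is inl _ then true else false) : bool)).
rewrite [X in measurable_fun _ X](_ : _ = EFin \o \1_q).
  by apply/measurable_EFinP; exact: measurable_indic.
apply/funext => w /=.
rewrite indicE (_ : (w \in q) = queries_at (run alg w) F n).
  by rewrite /queries_at; case: (run alg w _).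
by apply/idP/idP => [/set_mem|/mem_set].
Qed.

End Measurability.

(** * Averaging over the coins *)

Theorem theorem3 (R : realType) (A B : finType) (X : {set {ffun A -> B}})
    (H : instance X -> bool) (r : instance X -> instance X -> R)
    (r_ge0 : forall F1 F2, 0 <= r F1 F2)
    (r_neq0 : exists F1 F2, r F1 F2 != 0)
    (r_sym : forall F1 F2, r F1 F2 = r F2 F1)
    (r_label : forall F1 F2, H F1 = H F2 -> r F1 F2 = 0)
    (q_gt0 : exists Z : {set instance X}, 0 < max_separated_weight r Z) :
  (\big[mine/+oo]_(Z : {set instance X} | (0 < max_separated_weight r Z)%R)
      (total_weight r Z / (100 * max_separated_weight r Z))%:E
    <= randomized_query_complexity R H)%E.
Proof.
set t := (X in (X <= _)%E).
have M_ge0 Z : 0 <= total_weight r Z.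
  by apply: sumr_ge0 => F1 _; apply: sumr_ge0.
have t_ge0 : (0 <= t)%E.
  apply: le_bigmin => [|Z qZ]; first exact: leey.
  by rewrite lee_fin divr_ge0 // mulr_ge0 // ltW.
(* The default [+oo] of the minimum is excluded by [q_gt0]. *)
have t_fin : t \is a fin_num.
  have [Z qZ] := q_gt0; rewrite ge0_fin_numE //.
  by apply: le_lt_trans (ltry _); exact: bigmin_le_cond qZ.
rewrite -(fineK t_fin); set c := fine t.
have c_ge0 : 0 <= c by exact: fine_ge0.
(* Undoing the factor [100] makes [K] a lower bound for all ratios of [total_weight] to a positive
   [max_separated_weight]. *)
pose K := 100 * c.
have K_le (Z : {set instance X}) :
    K * max_separated_weight r Z <= total_weight r Z.
  have [qZ|qZ] := ltP 0 (max_separated_weight r Z); last first.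
    by apply: le_trans (M_ge0 Z); rewrite mulr_ge0_le0 // mulr_ge0.
  have : (t <= (total_weight r Z / (100 * max_separated_weight r Z))%:E)%E.
    exact: bigmin_le_cond qZ.
  rewrite -(fineK t_fin) lee_fin ler_pdivlMr ?mulr_gt0 //.
  by rewrite mulrA [_ * 100]mulrC.
have K_ge0 : 0 <= K by rewrite mulr_ge0.
have W_gt0 : 0 < total_weight r [set: instance X].
  have [F1 [F2 rF]] := r_neq0.
  rewrite /total_weight (bigD1 F1) ?inE //= (bigD1 F2) //= -addrA.
  rewrite ltr_pwDl ?lt_neqAle 1?eq_sym ?rF ?r_ge0 //.
  by rewrite addr_ge0 // sumr_ge0 // => F _; rewrite sumr_ge0.
apply: le_ereal_inf_tmp => _ [alg alg_correct <-].
have [S_lty|] := boolP (worst_case_queries X alg < +oo)%E; last first.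
  by rewrite -leNgt leye_eq => /eqP ->; exact: leey.
pose S := worst_case_queries X alg.
pose nq (F : instance X) w := num_queries R (run alg w) (val F).
pose bad (F : instance X) :=
  (~` [set w | outputs (run alg w) (val F) (H F)])%classic.
have bad_meas F : measurable (bad F).
  by apply: measurableC; exact: measurable_outputs.
have bad_le F : (coins_prob alg (bad F) <= (10^-1)%:E)%E.
  rewrite /bad probability_setC; last exact: measurable_outputs.
  have := alg_correct F.
  have := fin_num_measure (coins_prob alg) _
    (measurable_outputs alg (val F) (H F)).
  move=> /fineK <-; rewrite -EFinB !lee_fin; lra.
have nq_ge0 F w : (0 <= nq F w)%E by exact: num_queries_ge0.
have eq_le (F : instance X) : (expected_queries alg F <= S)%E.
  by apply: ereal_sup_ubound; exists F.
have eq_ge0 (F : instance X) : (0 <= expected_queries alg F)%E.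
  by apply: integral_ge0 => w _; exact: num_queries_ge0.
(* The summand of [weight_le_queries], with failure as an indicator; failure probability at most
   [1 / 10] bounds its mean by [S + 2 * K / 10]. *)
pose f F w := (nq F w + (2 * K)%:E * (\1_(bad F) w)%:E)%E.
have f_ge0 F w : (0 <= f F w)%E.
  by rewrite adde_ge0 // mule_ge0 // lee_fin // mulr_ge0.
have mbad F : measurable_fun setT
    ((fun w => (\1_(bad F) w)%:E) : coins alg -> \bar R).
  by apply/measurable_EFinP; exact: measurable_indic.
have mbad2 F : measurable_fun setT
    ((fun w => (2 * K)%:E * (\1_(bad F) w)%:E)%E : coins alg -> \bar R).
  exact: measurable_funeM.
have mf F : measurable_fun setT (f F : coins alg -> \bar R).
  by apply: emeasurable_funD => //; exact: measurable_num_queries.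
have intf F : (\int[coins_prob alg]_w f F w <= S + (K / 5)%:E)%E.
  rewrite ge0_integralD //; last 2 first.
  - exact: measurable_num_queries.
  - by move=> w _; rewrite mule_ge0 // lee_fin // mulr_ge0.
  rewrite leeD ?eq_le // ge0_integralZl_EFin ?mulr_ge0 //.
  rewrite integral_indic // setIT.
  apply: (@le_trans _ _ ((2 * K)%:E * (10^-1)%:E)%E).
    by apply: lee_wpmul2l => [|]; rewrite ?bad_le ?lee_fin ?mulr_ge0.
  rewrite -EFinM lee_fin; lra.
(* The bound for each outcome is integrated, and the finite sum is exchanged with the integral. *)
have : ((K * total_weight r [set: instance X])%:E <=
    (total_weight r [set: instance X])%:E * (S + (K / 5)%:E))%E.
  apply: (@le_trans _ _ (\int[coins_prob alg]_w
     (\sum_F (\sum_F' r F F')%:E * f F w))%E).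
    rewrite -[leLHS]mule1 -(@probability_setT _ _ _ (coins_prob alg)).
    rewrite -integral_cst //; apply: ge0_le_integral => //.
    - by move=> w _; rewrite lee_fin mulr_ge0.
    - by apply: emeasurable_sum => F; exact: measurable_funeM.
    move=> w _; apply: le_trans
      (weight_le_queries r_ge0 r_sym r_label K_ge0 K_le (run alg w)) _.
    apply: lee_sum => F _; rewrite lee_wpmul2l ?lee_fin ?sumr_ge0 //.
    rewrite leeD2l // lee_wpmul2l ?lee_fin ?mulr_ge0 // indicE.
    by case: asboolP => // fails; rewrite mem_set.
  rewrite ge0_integral_sum //; last 2 first.
  - by move=> F; exact: measurable_funeM.
  - by move=> F w _; rewrite mule_ge0 // lee_fin sumr_ge0.
  rewrite total_weightT.
  rewrite -sumEFin ge0_sume_distrl => [|F _]; last by rewrite lee_fin sumr_ge0.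
  apply: lee_sum => F _; rewrite ge0_integralZl_EFin ?sumr_ge0 //.
  by rewrite lee_wpmul2l ?lee_fin ?sumr_ge0.
(* An instance is needed for [0 <= S], as the supremum of the empty set is [-oo]. *)
have [F0 _] := r_neq0.
have S_fin : S \is a fin_num.
  by rewrite ge0_fin_numE //; apply: le_trans (eq_le F0).
(* Cancelling the positive total weight leaves [K <= S + K / 5], hence [S >= 80 * c >= c]. *)
rewrite -/S -(fineK S_fin) -EFinD -EFinM !lee_fin mulrC ler_pM2l // /K.
lra.
Qed.
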